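(* Let $\varepsilon,h,\Delta t,\Delta x>0$, $d\ge 0$, $q\in(0,1)$ and $J\in\mathbb{N}$. Let $u_j^k,v_j^k$ ($0\le j\le J$, $k\in\mathbb{N}\cup\{0\}$) be the numerical solutions obtained by solving alternately the reaction step $(D_o)$ and the diffusion step $(D_h)$ described in the context, with either homogeneous Neumann or periodic boundary conditions, starting from initial data $u_j^0,v_j^0$. Assume that \[ \frac{\Delta t}{\Delta x^2}\le\frac{1}{\max\{2,2d\}} . \] If $u_j^0,v_j^0\in(q,1)$ for all $j$, then $u_j^k,v_j^k\in(q,1)$ for all $j$ and all $k$.
   Context: The scheme discretizes the system $\partial_t u=\partial_x^2u+u(1-u)/\varepsilon-hv(u-q)/(u+q)$, $\partial_t v=d\,\partial_x^2 v-v+u$ on $[0,L]$, $L=J\Delta x$, with $u_j^k\approx u(j\Delta x,k\Delta t)$ and $v_j^k\approx v(j\Delta x,k\Delta t)$, by operator splitting. Set $\tilde u_j^0:=u_j^0$ and $\tilde v_j^0:=v_j^0$ for $0\le j\le J$. For $k=0,1,2,\dots$, perform successively the following two steps. Step $(D_o)$ (reaction): for each $0\le j\le J$, define $u_j^{k+1},v_j^{k+1}$ from $\tilde u_j^k,\tilde v_j^k$ by \[ \frac{u_j^{k+1}-\tilde u_j^k}{\Delta t}=\frac{\tilde u_j^k(1-u_j^{k+1})}{\varepsilon}-h\tilde v_j^k\,\frac{u_j^{k+1}-q}{\tilde u_j^k+q},\qquad \frac{v_j^{k+1}-\tilde v_j^k}{\Delta t}=-v_j^{k+1}+\tilde u_j^k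 . \] These equations are linear in $u_j^{k+1}$ and $v_j^{k+1}$. Step $(D_h)$ (diffusion): for each $0\le j\le J$, define $\tilde u_j^{k+1},\tilde v_j^{k+1}$ from $u^{k+1},v^{k+1}$ by \[ \frac{\tilde u_j^{k+1}-u_j^{k+1}}{\Delta t}=\frac{u_{j+1}^{k+1}-2u_j^{k+1}+u_{j-1}^{k+1}}{\Delta x^2},\qquad \frac{\tilde v_j^{k+1}-v_j^{k+1}}{\Delta t}=d\,\frac{v_{j+1}^{k+1}-2v_j^{k+1}+v_{j-1}^{k+1}}{\Delta x^2}. \] (If $d=0$ this gives $\tilde v_j^{k+1}=v_j^{k+1}$.) The values at indices $-1$ and $J+1$ used in $(D_h)$ are given by the boundary conditions. In the homogeneous Neumann case, $w_{-1}:=w_1$ and $w_{J+1}:=w_{J-1}$ for $w=u^{k+1}$ and $w=v^{k+1}$. In the periodic case, the initial data satisfy $u_0^0=u_J^0$ and $v_0^0=v_J^0$, and $w_{-1}:=w_{J-1}$, $w_{J+1}:=w_1$ for $w=u^{k+1}$ and $w=v^{k+1}$. *)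

(* Defs.v *)
From HB Require Import structures.
From mathcomp Require Import all_boot all_order all_algebra.
From mathcomp Require Import reals.

Set Implicit Arguments.
Unset Strict Implicit.
Unset Printing Implicit Defensive.

Import Order.TTheory GRing.Theory Num.Theory.
Local Open Scope ring_scope.

(* A profile [w : int -> R] carries the values w_0, ..., w_J on the grid
   together with the ghost values w_{-1} and w_{J+1}; its values at all other
   indices are never used. *)
Definition on_grid (J : nat) (j : int) : bool := 0 <= j <= J%:Z.

Variant boundary_condition := Neumann | Periodic.

Definition ghost_values (R : realType) (bc : boundary_condition) (J : nat)
    (w : int -> R) : Prop :=
  match bc with
  | Neumann => w (- 1) = w 1 /\ w (J%:Z + 1) = w (J%:Z - 1)
  | Periodic => w (- 1) = w (J%:Z - 1) /\ w (J%:Z + 1) = w 1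
  end.

Definition compatible_initial_data (R : realType) (bc : boundary_condition)
    (J : nat) (w : int -> R) : Prop :=
  match bc with
  | Neumann => True
  | Periodic => w 0 = w J%:Z
  end.

(* [ut], [vt] are the profiles entering the step, [u], [v] those it returns:
   the equations determine the latter implicitly. *)
Definition reaction_step (R : realType) (eps h q dt : R) (J : nat)
    (ut vt u v : int -> R) : Prop :=
  forall j : int, on_grid J j ->
    (u j - ut j) / dt
      = ut j * (1 - u j) / eps - h * vt j * ((u j - q) / (ut j + q))
    /\ (v j - vt j) / dt = - v j + ut j.

Definition diffusion_step (R : realType) (kappa dt dx : R) (J : nat)
    (w wt : int -> R) : Prop :=
  forall j : int, on_grid J j ->
    (wt j - w j) / dt
      = kappa * ((w (j + 1) - 2 * w j + w (j - 1)) / dx ^+ 2).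

(* The time index comes first: [u k j] is u_j^k, and [ut], [vt] are the
   diffused values (written with a tilde). *)
Record splitting_scheme (R : realType) (eps h d q dt dx : R) (J : nat)
    (bc : boundary_condition) (u v ut vt : nat -> int -> R) : Prop := {
  scheme_compat_u : compatible_initial_data bc J (u 0%N);
  scheme_compat_v : compatible_initial_data bc J (v 0%N);
  scheme_init_u : forall j : int, on_grid J j -> ut 0%N j = u 0%N j;
  scheme_init_v : forall j : int, on_grid J j -> vt 0%N j = v 0%N j;
  scheme_reaction : forall k : nat,
    reaction_step eps h q dt J (ut k) (vt k) (u k.+1) (v k.+1);
  scheme_ghost_u : forall k : nat, ghost_values bc J (u k.+1);
  scheme_ghost_v : forall k : nat, ghost_values bc J (v k.+1);
  scheme_diffusion_u : forall k : nat,
    diffusion_step 1 dt dx J (u k.+1) (ut k.+1);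
  scheme_diffusion_v : forall k : nat,
    diffusion_step d dt dx J (v k.+1) (vt k.+1)
}.

(* Main.v *)
Require Import Defs.
From HB Require Import structures.
From mathcomp Require Import all_boot all_order all_algebra.
From mathcomp Require Import reals.
From mathcomp Require Import zify ring lra.

Set Implicit Arguments.
Unset Strict Implicit.
Unset Printing Implicit Defensive.

Import Order.TTheory GRing.Theory Num.Theory.
Local Open Scope ring_scope.

(* Both steps are averaging steps. Solved for the new value, the reaction step
   makes u_j^{k+1} a weighted mean of its old value (in (q,1)), of 1 and of q,
   with positive weights 1/dt, ut/eps and h vt/(ut+q), and makes v_j^{k+1} a
   convex combination of the old v and u. The step restriction says that
   dt/dx^2 and d dt/dx^2 are at most 1/2, which makes the diffused values
   convex combinations of three neighbouring values. *)

Lemma reaction_step_bounds (R : realType) (eps h q dt : R) (J : nat)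
    (ut vt u v : int -> R) :
  0 < eps -> 0 < h -> 0 < dt -> 0 < q < 1 ->
  reaction_step eps h q dt J ut vt u v ->
  (forall j, on_grid J j -> q < ut j < 1) ->
  (forall j, on_grid J j -> q < vt j < 1) ->
  forall j, on_grid J j -> (q < u j < 1) /\ (q < v j < 1).
Proof.
move=> eps0 h0 dt0 /andP[q0 q1] step utP vtP j jJ.
have [equ eqv] := step j jJ.
have /andP[qu u1] := utP j jJ; have /andP[qv v1] := vtP j jJ.
set a := dt^-1; set b := ut j / eps; set c := h * vt j / (ut j + q).
have a0 : 0 < a by rewrite invr_gt0.
have b0 : 0 < b by rewrite divr_gt0 //; lra.
have c0 : 0 < c by rewrite divr_gt0 ?mulr_gt0 //; lra.
have {}equ : a * (u j - ut j) = b * (1 - u j) - c * (u j - q).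
  by rewrite [LHS]mulrC equ /b /c; ring.
have {}eqv : a * (v j - vt j) = ut j - v j.
  by rewrite [LHS]mulrC eqv addrC.
(* No division by the total weight [s] is needed: the sign of the gap [x - y] can be read off from
   [s * (x - y)]. *)
have gt_mean (s x y : R) : 0 < s -> s * (x - y) > 0 -> y < x.
  by move=> s0; rewrite pmulr_rgt0 // subr_gt0.
have abc0 : 0 < a + b + c by rewrite !addr_gt0.
have a10 : 0 < a + 1 by rewrite addr_gt0.
split; apply/andP; split.
(* Measured from [q], the term with weight [c] vanishes; measured from 1 in the next case, the term
   with weight [b] does. The remaining terms are positive. *)
- apply: (gt_mean _ _ _ abc0).
  have -> : (a + b + c) * (u j - q) = a * (ut j - q) + b * (1 - q) by lra.
  by rewrite addr_gt0 // mulr_gt0 // subr_gt0.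
- apply: (gt_mean _ _ _ abc0).
  have -> : (a + b + c) * (1 - u j) = a * (1 - ut j) + c * (1 - q) by lra.
  by rewrite addr_gt0 // mulr_gt0 // subr_gt0.
- apply: (gt_mean _ _ _ a10).
  have -> : (a + 1) * (v j - q) = a * (vt j - q) + (ut j - q) by lra.
  by rewrite addr_gt0 ?mulr_gt0 // subr_gt0.
- apply: (gt_mean _ _ _ a10).
  have -> : (a + 1) * (1 - v j) = a * (1 - vt j) + (1 - ut j) by lra.
  by rewrite addr_gt0 ?mulr_gt0 // subr_gt0.
Qed.

(** Under either boundary condition a ghost value copies the value at index 1 or [J - 1], and both
    indices lie on the grid because [0 < J]. *)
Lemma ghost_values_bounds (R : realType) (bc : boundary_condition) (J : nat)
    (w : int -> R) (P : R -> Prop) :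
  (0 < J)%N -> ghost_values bc J w ->
  (forall j, on_grid J j -> P (w j)) ->
  forall j, on_grid J j -> P (w (j + 1)) /\ P (w (j - 1)).
Proof.
move=> J0 ghost wP j; rewrite /on_grid => /andP[j0 jJ].
have w1 : P (w 1) by apply: wP; rewrite /on_grid; lia.
have wJ1 : P (w (J%:Z - 1)) by apply: wP; rewrite /on_grid; lia.
have [wl wr] : P (w (- 1)) /\ P (w (J%:Z + 1)).
  by case: bc ghost => -[-> ->].
split.
- have [->//|jneJ] := eqVneq j J%:Z.
  by apply: wP; rewrite /on_grid; lia.
- have [->|jne0] := eqVneq j 0; first by rewrite sub0r.
  by apply: wP; rewrite /on_grid; lia.
Qed.

Lemma diffusion_step_bounds (R : realType) (kappa dt dx lo hi : R) (J : nat)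
    (bc : boundary_condition) (w wt : int -> R) :
  0 < dt -> 0 <= kappa -> kappa * (dt / dx ^+ 2) <= 1 / 2 ->
  (0 < J)%N -> ghost_values bc J w -> diffusion_step kappa dt dx J w wt ->
  (forall j, on_grid J j -> lo < w j < hi) ->
  forall j, on_grid J j -> lo < wt j < hi.
Proof.
move=> dt0 kappa0 stab J0 ghost step wP j jJ.
have /andP[wl wh] := wP j jJ.
have [/andP[rl rh] /andP[ll lh]] :=
  ghost_values_bounds (P := fun x => lo < x < hi) J0 ghost wP jJ.
set lam := kappa * (dt / dx ^+ 2) in stab *.
have lam0 : 0 <= lam by rewrite mulr_ge0 // divr_ge0 ?sqr_ge0 // ltW.
have wtE : wt j = w j + lam * (w (j + 1) - 2 * w j + w (j - 1)).
  have dtN0 : dt != 0 by rewrite gt_eqF.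
  have /(canRL (divfK dtN0)) /eqP := step j jJ.
  rewrite subr_eq => /eqP ->; rewrite /lam; ring.
(* The two cases keep the inequality strict at both extremes: for [lam = 0] (possible when
   [kappa = 0]) only [x] remains, and for [lam > 0] the neighbours suffice even if [1 - 2 * lam]
   vanishes. *)
have convex_gt0 (x y z : R) : 0 < x -> 0 < y -> 0 < z ->
    0 < (1 - 2 * lam) * x + lam * (y + z).
  move=> x0 y0 z0; have [lam_eq0|lam_neq0] := eqVneq lam 0.
    by rewrite lam_eq0; lra.
  rewrite ltr_wpDl ?mulr_ge0 ?(ltW x0) //; first lra.
  by rewrite mulr_gt0 ?addr_gt0 // lt_neqAle eq_sym lam_neq0.
(* Since the weights sum to 1, the gap between [wt j] and either bound is the same combination of
   the gaps of the three old values. *)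
have lowP := convex_gt0 (w j - lo) (w (j + 1) - lo) (w (j - 1) - lo).
have highP := convex_gt0 (hi - w j) (hi - w (j + 1)) (hi - w (j - 1)).
rewrite !subr_gt0 in lowP highP.
apply/andP; split; rewrite wtE.
- by have := lowP wl rl ll; lra.
- by have := highP wh rh lh; lra.
Qed.

(** The maximum dominates both 2 and [2 * d]. Multiplying the bound on [r] by [d], rather than
    dividing by it, covers [d = 0] as well. *)
Lemma stability_bound (R : realType) (d r : R) :
  0 <= d -> r <= 1 / Num.max 2 (2 * d) ->
  1 * r <= 1 / 2 /\ d * r <= 1 / 2.
Proof.
move=> d0; set M := Num.max _ _.
have M2 : 2 <= M by rewrite le_max lexx.
have Md : 2 * d <= M by rewrite le_max lexx orbT.
have M0 : 0 < M by lra.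
move=> rM; split.
- rewrite mul1r (le_trans rM) // !div1r lef_pV2 // ?posrE //.
- apply: le_trans (ler_wpM2l d0 rM) _.
  by rewrite mul1r ler_pdivrMr //; lra.
Qed.

Theorem theorem3 (R : realType) (eps h d q dt dx : R) (J : nat)
    (bc : boundary_condition) (u v ut vt : nat -> int -> R)
    (heps : 0 < eps) (hh : 0 < h) (hdt : 0 < dt) (hdx : 0 < dx)
    (hd : 0 <= d) (hq : 0 < q < 1) (hJ : (0 < J)%N)
    (hsol : splitting_scheme eps h d q dt dx J bc u v ut vt)
    (hstab : dt / dx ^+ 2 <= 1 / Num.max 2 (2 * d))
    (hu0 : forall j : int, on_grid J j -> q < u 0%N j < 1)
    (hv0 : forall j : int, on_grid J j -> q < v 0%N j < 1) :
  forall (k : nat) (j : int), on_grid J j ->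
    (q < u k j < 1) /\ (q < v k j < 1).
Proof.
have [stab1 stabd] := stability_bound hd hstab.
have step k :
    (forall j, on_grid J j -> q < ut k j < 1) ->
    (forall j, on_grid J j -> q < vt k j < 1) ->
    forall j, on_grid J j -> (q < u k.+1 j < 1) /\ (q < v k.+1 j < 1).
  exact: reaction_step_bounds heps hh hdt hq (scheme_reaction hsol k).
(* The induction runs on the diffused values, since these are what the reaction step takes as input;
   the bounds on [u] and [v] at time [k.+1] then cost one more reaction step. *)
have tilde k : (forall j, on_grid J j -> q < ut k j < 1) /\
    (forall j, on_grid J j -> q < vt k j < 1).
  elim: k => [|k [utP vtP]].
    by split=> j jJ; rewrite ?(scheme_init_u hsol) ?(scheme_init_v hsol) //;
       [exact: hu0|exact: hv0].
  have uvP := step k utP vtP; split.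
  - apply: (diffusion_step_bounds hdt ler01 stab1 hJ (scheme_ghost_u hsol k)
              (scheme_diffusion_u hsol k)).
    by move=> j /uvP[].
  - apply: (diffusion_step_bounds hdt hd stabd hJ (scheme_ghost_v hsol k)
              (scheme_diffusion_v hsol k)).
    by move=> j /uvP[].
case=> [|k] j jJ; first by split; [exact: hu0|exact: hv0].
by have [utP vtP] := tilde k; exact: step utP vtP j jJ.
Qed.
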